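(* Let $F=\{p_0,\ldots,p_n\}\subset\mathbb{R}$ contain at least two distinct points, let $k\ge1$, and consider the homogeneous IFS $S_i(x)=\lambda x+(1-\lambda)p_i$, $i=0,\ldots,n$. Then for every $\lambda\in\big(\max\{(\tfrac12)^{1/(k(n+1)^k)},\theta^{-1/2}\},1\big)$, where $\theta=1.3247\ldots$ is the smallest Pisot number (the real root of $x^3-x-1$), we have $X_k=\mathrm{int}(X)$.
   Context: $\mathcal{D}=\{0,\ldots,n\}$. $X\subset\mathbb{R}$ is the unique non-empty compact set with $X=\bigcup_{i\in\mathcal{D}}S_i(X)$. The coding map is $\pi(\mathbf{a})=\lim_{j\to\infty}(S_{a_1}\circ\cdots\circ S_{a_j})(0)$. For $\mathbf{b}\in\mathcal{D}^k$, $\mathrm{freq}_{\mathbf{b}}(\mathbf{a})=\lim_{m\to\infty}\frac1m\#\{1\le j\le m:a_j\cdots a_{j+k-1}=\mathbf{b}\}$; $\mathbf{a}$ is $k$-simply normal if this equals $(n+1)^{-k}$ for all $\mathbf{b}\in\mathcal{D}^k$. $X_k$ is the set of $x\in X$ having a $k$-simply normal $\mathbf{a}$ with $\pi(\mathbf{a})=x$. *)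

(* Defs.v *)
From HB Require Import structures.
From mathcomp Require Import all_boot all_order all_algebra.
From mathcomp Require Import all_classical all_reals all_analysis.
Set Implicit Arguments. Unset Strict Implicit. Unset Printing Implicit Defensive.
Import Order.TTheory GRing.Theory Num.Theory.
Import numFieldNormedType.Exports.
Local Open Scope classical_set_scope.
Local Open Scope ring_scope.

Definition ifs_map (R : realType) (n : nat) (lam : R) (p : 'I_n.+1 -> R)
  (i : 'I_n.+1) (x : R) : R := lam * x + (1 - lam) * p i.

Definition is_attractor (R : realType) (n : nat) (lam : R) (p : 'I_n.+1 -> R)
  (X : set R) : Prop :=
  X !=set0 /\ compact X /\ X = \bigcup_(i in [set: 'I_n.+1]) (ifs_map lam p i @` X).

(* (S_{a_1} o ... o S_{a_j})(x), with a indexed from 0 (a 0 = a_1). *)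
Fixpoint ifs_comp (R : realType) (n : nat) (lam : R) (p : 'I_n.+1 -> R)
  (a : nat -> 'I_n.+1) (j : nat) (x : R) : R :=
  match j with
  | 0 => x
  | j'.+1 => ifs_map lam p (a 0%N) (ifs_comp lam p (fun m => a m.+1) j' x)
  end.

Definition coding_map (R : realType) (n : nat) (lam : R) (p : 'I_n.+1 -> R)
  (a : nat -> 'I_n.+1) : R := limn (fun j => ifs_comp lam p a j 0).

Definition block_count_ratio (R : realType) (n k : nat) (a : nat -> 'I_n.+1)
  (b : k.-tuple 'I_n.+1) (m : nat) : R :=
  (#|[set j : 'I_m | [forall i : 'I_k, a (j + i)%N == tnth b i]]|)%:R / m%:R.

Definition k_simply_normal (R : realType) (n k : nat) (a : nat -> 'I_n.+1) : Prop :=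
  forall b : k.-tuple 'I_n.+1,
    block_count_ratio R a b @ \oo --> ((n.+1)%:R ^- k : R).

Definition Xk (R : realType) (n k : nat) (lam : R) (p : 'I_n.+1 -> R)
  (X : set R) : set R :=
  [set x | X x /\ exists a : nat -> 'I_n.+1,
      k_simply_normal R k a /\ coding_map lam p a = x].

(* Main.v *)
(* Let [C] be the periodic word obtained by concatenating all words of length [k]
   in lexicographic order; each block of length [k] occurs exactly [k] times in
   a period [N = k (n+1)^k]. Let [i0] be a letter with [p i0] minimal, playing
   the role of the first letter, so that [C] starts with [k] copies of [i0].
   The words [w1 = C(0)...C(N-1)] and [w2 = C(1)...C(N)] are rotations of each
   other and both start with [k - 1] copies of [i0], so every concatenation of
   copies of [w1] and [w2] is [k]-simply normal. As [lam^N >= 1/2], these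
   concatenations code the whole interval [[c, d]] between the fixed points of
   the maps of [w1] and [w2]. Moreover [c] is the image of [d] under the map of
   [i0], so that iterating the inverse of this map moves any point between
   [p i0] and [c] into [[c, d]] without jumping over it. Points on the right of
   [d] are first moved to the left with the inverse of the map of a letter [i1]
   with [p i1] maximal. Prepending finitely many letters preserves normality. *)
Require Import Defs.
From HB Require Import structures.
From mathcomp Require Import all_boot all_order all_algebra perm.
From mathcomp Require Import all_classical all_reals all_analysis.
From mathcomp Require Import zify ring lra.
Set Implicit Arguments. Unset Strict Implicit. Unset Printing Implicit Defensive.
Import Order.TTheory GRing.Theory Num.Theory.
Import numFieldNormedType.Exports.
Local Open Scope classical_set_scope.
Local Open Scope ring_scope.

(** * Words with equidistributed blocks *)

Section Words.
Local Open Scope nat_scope.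

Definition digit (B i q : nat) : nat := q %/ B ^ i %% B.

Lemma eq_digits_modn (B l q q' : nat) :
  (forall i, i < l -> digit B i q = digit B i q') -> q = q' %[mod B ^ l].
Proof.
elim: l q q' => [|l IH] q q' eq_qq'; first by rewrite !modn1.
have eq_div : q %/ B = q' %/ B %[mod B ^ l].
  by apply: IH => i ltil; have := eq_qq' i.+1 ltil; rewrite /digit expnS !divnMA.
have eq_mod : q = q' %[mod B] by have := eq_qq' 0 isT; rewrite /digit !divn1.
rewrite (divn_eq q B) (divn_eq q' B) eq_mod expnSr -modnDml -muln_modl eq_div.
by rewrite muln_modl modnDml.
Qed.

Lemma digit_mod (B l i q : nat) : i < l -> digit B i (q %% B ^ l) = digit B i q.
Proof.
move=> ltil; case: (posnP B) => [->|B0].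
  by rewrite (exp0n (leq_ltn_trans _ ltil))// modn0.
rewrite /digit {2}(divn_eq q (B ^ l)).
have -> : B ^ l = B ^ (l - i.+1) * B * B ^ i.
  by rewrite -expnSr -expnD; congr (_ ^ _); lia.
by rewrite !mulnA divnMDl ?expn_gt0 ?B0// modnMDl.
Qed.

Lemma sum_nat_mul (m l : nat) (F : nat -> nat) :
  \sum_(0 <= j < m * l) F j = \sum_(0 <= q < m) \sum_(0 <= r < l) F (q * l + r).
Proof.
elim: m => [|m IH]; first by rewrite !big_nil.
rewrite big_nat_recr//= -IH mulSnr (big_cat_nat (n := m * l)) ?leq_addr//=.
congr addn; rewrite -{1}[m * l]add0n big_addn addKn.
by apply: eq_bigr => r _; rewrite addnC.
Qed.

Lemma sum_nat_shift (l : nat) (F : nat -> nat) : F l = F 0 ->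
  \sum_(0 <= j < l) F j.+1 = \sum_(0 <= j < l) F j.
Proof.
move=> Fl0; apply/eqP; rewrite -(eqn_add2l (F 0)) -big_nat_recl//.
by rewrite big_nat_recr//= Fl0 addnC.
Qed.

Definition occurs (T : eqType) (k : nat) (a : nat -> T) (b : k.-tuple T) (j : nat) :=
  [forall i : 'I_k, a (j + i) == tnth b i].

Definition occurrences (T : eqType) (k : nat) (a : nat -> T) (b : k.-tuple T)
  (m : nat) : nat := \sum_(0 <= j < m) occurs a b j.

Lemma eq_occurs (T : eqType) (k : nat) (a a' : nat -> T) (b : k.-tuple T) (j j' : nat) :
  (forall i, i < k -> a (j + i) = a' (j' + i)) -> occurs a b j = occurs a' b j'.
Proof. by move=> eqa; apply: eq_forallb => i; rewrite eqa. Qed.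

(* The word obtained by concatenating all words of length [k] in lexicographic
   order, repeated periodically.  The letters [ord0] and [i0] are exchanged,
   so that the word starts with [k] copies of [i0]. *)
Definition lex_word (n k : nat) (i0 : 'I_n.+1) (j : nat) : 'I_n.+1 :=
  tperm ord0 i0 (inord (digit n.+1 (k - (j %% k).+1) (j %/ k))).

Definition lex_period (n k : nat) : nat := n.+1 ^ k * k.

Lemma lex_word_periodM (n k : nat) (i0 : 'I_n.+1) (i j : nat) : 0 < k ->
  lex_word k i0 (i * lex_period n k + j) = lex_word k i0 j.
Proof.
move=> k0; rewrite /lex_word /lex_period mulnA modnMDl divnMDl//.
have ltk : k - (j %% k).+1 < k by lia.
by rewrite -(digit_mod _ _ ltk) modnMDl digit_mod.
Qed.

Lemma lex_word_prefix (n k : nat) (i0 : 'I_n.+1) (j : nat) : j < k ->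
  lex_word k i0 j = i0.
Proof.
move=> ltjk; rewrite /lex_word divn_small// /digit div0n mod0n.
by rewrite (_ : inord 0 = ord0) ?tpermL//; apply/val_inj; rewrite /= inordK.
Qed.

Lemma lex_word_digit (n k : nat) (i0 : 'I_n.+1) (q q' i : nat) : i < k ->
  lex_word k i0 (q * k + i) = lex_word k i0 (q' * k + i) ->
  digit n.+1 (k - i.+1) q = digit n.+1 (k - i.+1) q'.
Proof.
move=> ltik; rewrite /lex_word !modnMDl !divnMDl ?(leq_ltn_trans _ ltik)//.
rewrite modn_small// divn_small// !addn0 => /perm_inj /(congr1 (@nat_of_ord _)).
by rewrite !inordK// ltn_mod.
Qed.

(* A block at offset [r] is made of the last [k - r] digits of [q] and of the
   first [r] digits of [q + 1]; the former determine the last [k - r] digits of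
   [q + 1]. *)
Lemma lex_word_block_inj (n k : nat) (i0 : 'I_n.+1) (r q q' : nat) : r < k ->
  q < n.+1 ^ k -> q' < n.+1 ^ k ->
  (forall i, i < k ->
    lex_word k i0 (q * k + r + i) = lex_word k i0 (q' * k + r + i)) ->
  q = q'.
Proof.
move=> ltrk ltq ltq' eqw.
have low : q = q' %[mod n.+1 ^ (k - r)].
  apply: eq_digits_modn => e lte.
  have -> : e = k - (k - e.+1).+1 by lia.
  apply: (@lex_word_digit _ _ i0); first by lia.
  have := eqw (k - e.+1 - r); rewrite -!addnA subnKC; last by lia.
  by apply; lia.
suff : q + 1 = q' + 1 %[mod n.+1 ^ k].
  by move/eqP; rewrite eqn_modDr !modn_small// => /eqP.
apply: eq_digits_modn => e lte; case: (ltnP e (k - r)) => [ltekr|leekr].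
  rewrite -(digit_mod _ (q + 1) ltekr) -(digit_mod _ (q' + 1) ltekr).
  by rewrite -modnDml low modnDml.
have -> : e = k - (k - e.+1).+1 by lia.
apply: (@lex_word_digit _ _ i0); first by lia.
have := eqw (k - r + (k - e.+1)); rewrite !mulnDl !mul1n -!addnA.
by rewrite !(addnA r) subnKC ?(ltnW ltrk)//; apply; lia.
Qed.

(** For a fixed offset [r], sending [q] to the block at [q * k + r] is injective, hence bijective
    onto the words of length [k] by cardinality. So [b] occurs exactly once at each of the [k]
    offsets. *)
Lemma lex_word_occurrences (n k : nat) (i0 : 'I_n.+1) (b : k.-tuple 'I_n.+1) :
  occurrences (lex_word k i0) b (lex_period n k) = k.
Proof.
rewrite /occurrences sum_nat_mul exchange_big_nat/=.
rewrite -[RHS](subn0 k) -[RHS]muln1 -sum_nat_const_nat.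
apply: eq_big_nat => r /andP[_ ltrk]; rewrite big_mkord.
pose f (q : 'I_(n.+1 ^ k)) := [tuple lex_word k i0 (q * k + r + i) | i < k].
have finj : injective f.
  move=> q q' eqf; apply: val_inj.
  apply: (@lex_word_block_inj n k i0 r _ _ ltrk (ltn_ord q) (ltn_ord q')) => i ltik.
  by have := congr1 (fun t => tnth t (Ordinal ltik)) eqf; rewrite !tnth_mktuple.
have [g fK gK] : bijective f.
  by apply: inj_card_bij => //; rewrite card_tuple !card_ord.
have occE (q : 'I_(n.+1 ^ k)) : occurs (lex_word k i0) b (q * k + r) = (q == g b).
  rewrite -(can_eq fK) gK; apply/forallP/eqP => [occ|fb i].
    by apply: eq_from_tnth => i; rewrite tnth_mktuple; exact/eqP.
  by rewrite -fb tnth_mktuple.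
rewrite (bigD1 (g b))//= occE eqxx big1// => q /negPf qgb.
by rewrite occE qgb.
Qed.

(* An arbitrary concatenation of the words [C(0)...C(N-1)] and [C(1)...C(N)]
   chosen according to [e], where [C] is [lex_word] and [N] its period. *)
Definition shuffle_word (n k : nat) (i0 : 'I_n.+1) (e : nat -> bool) (j : nat) : 'I_n.+1 :=
  lex_word k i0 (j + e (j %/ lex_period n k)).

(* Both words start with [k - 1] copies of [i0], hence a block straddling two
   consecutive words does not depend on the second one. *)
Lemma occurs_shuffle_word (n k : nat) (i0 : 'I_n.+1) (e : nat -> bool)
  (b : k.-tuple 'I_n.+1) (i s : nat) : 0 < k -> s < lex_period n k ->
  occurs (shuffle_word k i0 e) b (i * lex_period n k + s) =
  occurs (lex_word k i0) b (s + e i).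
Proof.
move=> k0 ltsN; have leN : k <= lex_period n k.
  by rewrite leq_pmull// expn_gt0.
apply: eq_occurs => t lttk; rewrite /shuffle_word -(addnA _ s t) divnMDl; last lia.
rewrite -addnA lex_word_periodM//.
have [ltN|geN] := ltnP (s + t) (lex_period n k).
  by rewrite divn_small// addn0 addnAC.
(* An index past the window is at most [k - 2], so adding the shift given by [e] keeps it among the
   first [k] letters, all equal to [i0]. *)
have lt2 : s + t - lex_period n k < k.-1 by lia.
have -> : (s + t) %/ lex_period n k = 1.
  by rewrite -(subnK geN) divnDr// divnn divn_small; lia.
have -> : s + t + e (i + 1) = 1 * lex_period n k + (s + t - lex_period n k + e (i + 1)).
  by lia.
have -> : s + e i + t = 1 * lex_period n k + (s + t - lex_period n k + e i) by lia.
rewrite !lex_word_periodM// !lex_word_prefix//; [case: (e i)|case: (e _)]; lia.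
Qed.

(** Each window contributes a sum over a full period of [lex_word], possibly shifted by one;
    periodicity makes the shift harmless. *)
Lemma shuffle_word_occurrences (n k : nat) (i0 : 'I_n.+1) (e : nat -> bool)
  (b : k.-tuple 'I_n.+1) (i : nat) : 0 < k ->
  occurrences (shuffle_word k i0 e) b (i * lex_period n k) = i * k.
Proof.
move=> k0; rewrite /occurrences sum_nat_mul -[in RHS](subn0 i) -sum_nat_const_nat.
apply: eq_bigr => q _; rewrite -[RHS](lex_word_occurrences i0 b).
transitivity (\sum_(0 <= s < lex_period n k) occurs (lex_word k i0) b (s + e q)).
  by apply: eq_big_nat => s /andP[_ lts]; rewrite occurs_shuffle_word.
case: (e q); last by apply: eq_bigr => s _; rewrite addn0.
under eq_bigr do rewrite addn1.
rewrite (@sum_nat_shift _ (fun s => occurs (lex_word k i0) b s : nat))//.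
congr nat_of_bool; apply: eq_occurs => t _; rewrite add0n.
by rewrite -[lex_period n k]mul1n lex_word_periodM.
Qed.

(** Frequency [n.+1 ^- k] with error [O(1/m)], cleared of denominators: a strong form of normality
    that is easy to transfer to a word with one more letter in front. *)
Definition bounded_discrepancy (n k : nat) (a : nat -> 'I_n.+1) : Prop :=
  forall b : k.-tuple 'I_n.+1, exists K, forall m,
    occurrences a b m * n.+1 ^ k <= m + K /\ m <= occurrences a b m * n.+1 ^ k + K.

Lemma leq_occurrences (T : eqType) (k : nat) (a : nat -> T) (b : k.-tuple T)
  (m m' : nat) : m <= m' -> occurrences a b m <= occurrences a b m'.
Proof.
by move=> lem; rewrite /occurrences (big_cat_nat (n := m) (p := m'))//= leq_addr.
Qed.

(** The discrepancy vanishes at multiples of the period; in between, monotonicity of the count costs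
    at most one period. *)
Lemma shuffle_word_discrepancy (n k : nat) (i0 : 'I_n.+1) (e : nat -> bool) :
  0 < k -> bounded_discrepancy k (shuffle_word k i0 e).
Proof.
move=> k0 b; exists (lex_period n k) => m.
have N0 : 0 < lex_period n k by rewrite muln_gt0 expn_gt0.
have ltm := ltn_pmod m N0; have eqm := divn_eq m (lex_period n k).
have lem : m <= (m %/ lex_period n k).+1 * lex_period n k.
  by rewrite {1}eqm mulSn addnC leq_add2r ltnW.
have lo := leq_occurrences (shuffle_word k i0 e) b (leq_trunc_div m (lex_period n k)).
have hi := leq_occurrences (shuffle_word k i0 e) b lem.
rewrite !shuffle_word_occurrences// in lo hi.
move: (leq_mul lo (leqnn (n.+1 ^ k))) (leq_mul hi (leqnn (n.+1 ^ k))).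
rewrite -!mulnA [k * _]mulnC -/(lex_period n k) mulSn => {}lo {}hi; split.
  by rewrite (leq_trans hi)// addnC leq_add2r leq_trunc_div.
by rewrite {1}eqm leq_add// ltnW.
Qed.

Definition cons_word (T : Type) (x : T) (a : nat -> T) (j : nat) : T :=
  if j is j'.+1 then a j' else x.

Lemma cons_word_discrepancy (n k : nat) (i : 'I_n.+1) (a : nat -> 'I_n.+1) :
  bounded_discrepancy k a -> bounded_discrepancy k (cons_word i a).
Proof.
move=> abd b; have [K aK] := abd b.
exists (K + n.+1 ^ k + 1) => -[|m]; first by rewrite /occurrences big_nil; lia.
have [a1 a2] := aK m.
rewrite /occurrences big_nat_recl// -/(occurrences a b m) mulnDl.
by case: (occurs _ b 0); lia.
Qed.

End Words.

(** * Compositions of the maps *)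

Section IteratedMaps.
Context (R : realType) (n : nat) (lam : R) (p : 'I_n.+1 -> R).
Implicit Types (a : nat -> 'I_n.+1) (i : 'I_n.+1).

Lemma ifs_mapB i x y : ifs_map lam p i x - ifs_map lam p i y = lam * (x - y).
Proof. by rewrite /ifs_map; ring. Qed.

Lemma ifs_compB a j x y :
  ifs_comp lam p a j x - ifs_comp lam p a j y = lam ^+ j * (x - y).
Proof.
elim: j a => [|j IH] a /=; first by rewrite mul1r.
by rewrite ifs_mapB IH exprS mulrA.
Qed.

Lemma ifs_compD a j j' x : ifs_comp lam p a (j + j') x =
  ifs_comp lam p a j (ifs_comp lam p (fun m => a (j + m)%N) j' x).
Proof. by elim: j a => [|j IH] a //=; rewrite IH. Qed.

Lemma eq_ifs_comp a a' j x : (forall m, (m < j)%N -> a m = a' m) ->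
  ifs_comp lam p a j x = ifs_comp lam p a' j x.
Proof.
elim: j a a' => [|j IH] a a' eqa //=.
by rewrite eqa// (IH _ (fun m => a' m.+1)) // => m ltm; rewrite eqa.
Qed.

(** This reflection turns lower bounds into upper bounds. *)
Lemma ifs_comp_opp a j x :
  ifs_comp lam (fun i => - p i) a j (- x) = - ifs_comp lam p a j x.
Proof. by elim: j a => [|j IH] a //=; rewrite IH /ifs_map; ring. Qed.

End IteratedMaps.

(** * Bounds and convergence for compositions of contractions *)

Section Contraction.
Context (R : realType) (n : nat) (lam : R).
Hypotheses (lam_gt0 : 0 < lam) (lam_lt1 : lam < 1).
Implicit Types (p : 'I_n.+1 -> R) (a : nat -> 'I_n.+1) (i : 'I_n.+1).

Lemma ifs_comp_ge p lo a j x : (forall i, lo <= p i) ->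
  lo + lam ^+ j * (x - lo) <= ifs_comp lam p a j x.
Proof.
move=> plo; elim: j a => [|j IH] a /=; first by rewrite expr0; lra.
have := IH (fun m => a m.+1); have := plo (a 0%N); rewrite /ifs_map exprS.
set y := ifs_comp _ _ _ _ _; set t := lam ^+ j * _ => h1 h2.
rewrite -mulrA -/t.
have -> : lo + lam * t = lam * (lo + t) + (1 - lam) * lo by ring.
by apply: lerD; rewrite ler_pM2l// subr_gt0.
Qed.

(** The composition is [lam ^+ j * x] plus the sum of the [(1 - lam) * lam ^+ i * p (a i)]; every
    letter except the one at [j'] is estimated by [lo]. *)
Lemma ifs_comp_ge_letter p lo a j j' x : (forall i, lo <= p i) -> (j' < j)%N ->
  lo + (1 - lam) * lam ^+ j' * (p (a j') - lo) + lam ^+ j * (x - lo) <=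
  ifs_comp lam p a j x.
Proof.
move=> plo; elim: j a j' => [//|j IH] a [_|j' ltj] /=.
  have := ifs_comp_ge (fun m => a m.+1) j x plo; rewrite /ifs_map exprS expr0.
  set y := ifs_comp _ _ _ _ _; set t := lam ^+ j * _ => h1.
  rewrite -[lam * lam ^+ j * _]mulrA -/t mulr1.
  have -> : lo + (1 - lam) * (p (a 0%N) - lo) + lam * t =
    lam * (lo + t) + (1 - lam) * p (a 0%N) by ring.
  by rewrite lerD2r ler_pM2l.
have := IH (fun m => a m.+1) j' ltj; have := plo (a 0%N).
rewrite /ifs_map !exprS.
set y := ifs_comp _ _ _ _ _; set t := lam ^+ j * _; set s := p (a j'.+1) - lo.
rewrite -[lam * lam ^+ j * _]mulrA -/t => h1 h2.
have -> : lo + (1 - lam) * (lam * lam ^+ j') * s + lam * t =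
  lam * (lo + (1 - lam) * lam ^+ j' * s + t) + (1 - lam) * lo by ring.
by apply: lerD; rewrite ler_pM2l// subr_gt0.
Qed.

Lemma ifs_comp_le p hi a j x : (forall i, p i <= hi) ->
  ifs_comp lam p a j x <= hi + lam ^+ j * (x - hi).
Proof.
move=> phi; have phi' i : - hi <= - p i by rewrite lerN2.
have := ifs_comp_ge a j (- x) phi'; rewrite ifs_comp_opp.
by set y := ifs_comp _ _ _ _ _; nra.
Qed.

Lemma ifs_comp_le_letter p hi a j j' x : (forall i, p i <= hi) -> (j' < j)%N ->
  ifs_comp lam p a j x <=
  hi - (1 - lam) * lam ^+ j' * (hi - p (a j')) + lam ^+ j * (x - hi).
Proof.
move=> phi ltj; have phi' i : - hi <= - p i by rewrite lerN2.
have := ifs_comp_ge_letter a (- x) phi' ltj; rewrite ifs_comp_opp.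
by set y := ifs_comp _ _ _ _ _; nra.
Qed.

Lemma cvg_contraction (c : R) : (fun j => lam ^+ j * c) @ \oo --> (0 : R).
Proof.
rewrite -[0](mul0r c); apply: cvgMr_tmp; apply: cvg_expr.
by rewrite ger0_norm// ltW.
Qed.

Lemma ifs_comp_cvg_start p a x y (l : R) :
  ifs_comp lam p a ^~ x @ \oo --> l -> ifs_comp lam p a ^~ y @ \oo --> l.
Proof.
move=> xl; rewrite -[l]addr0.
have -> : ifs_comp lam p a ^~ y =
    (fun j => ifs_comp lam p a j x + lam ^+ j * (y - x)).
  by apply/funext => j; rewrite -(ifs_compB lam p a) addrC subrK.
by apply: cvgD => //; exact: cvg_contraction.
Qed.

(** Started at the minimum of [p], the sequence is nondecreasing and bounded by the maximum; the
    starting point does not affect the limit. *)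
Lemma is_cvg_ifs_comp p a x : cvgn (ifs_comp lam p a ^~ x).
Proof.
pose lo := p [arg min_(i < ord0) p i]%O; pose hi := p [arg max_(i > ord0) p i]%O.
have plo i : lo <= p i by rewrite /lo; case: arg_minP => // j _; exact.
have phi i : p i <= hi by rewrite /hi; case: arg_maxP => // j _; exact.
have cvg_lo : cvgn (ifs_comp lam p a ^~ lo).
  apply: nondecreasing_is_cvgn.
    apply/nondecreasing_seqP => j; rewrite -addn1 ifs_compD -subr_ge0 ifs_compB.
    apply: mulr_ge0; first by rewrite exprn_ge0// ltW.
    rewrite /= /ifs_map.
    have -> : lam * lo + (1 - lam) * p (a (j + 0)%N) - lo =
      (1 - lam) * (p (a (j + 0)%N) - lo) by ring.
    by rewrite mulr_ge0// subr_ge0// ltW.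
  exists hi => _ [j _ <-]; apply: le_trans (ifs_comp_le _ _ _ phi) _.
  rewrite gerDl mulr_ge0_le0 ?exprn_ge0 ?(ltW lam_gt0)// subr_le0.
  exact: le_trans (plo ord0) (phi ord0).
by apply/cvg_ex; eexists; apply: ifs_comp_cvg_start cvg_lo.
Qed.

Lemma cvg_cons_word p i a x (l : R) : ifs_comp lam p a ^~ x @ \oo --> l ->
  ifs_comp lam p (cons_word i a) ^~ x @ \oo --> ifs_map lam p i l.
Proof.
move=> al; rewrite -cvg_shiftS /=.
by apply: cvgD; [exact: cvgMl_tmp | exact: cvg_cst].
Qed.

(** The point [y 0] is the image of the bounded [y m] under the first [m * N] maps, which gives the
    limit along multiples of [N]. As the whole sequence converges, its limit is the same. *)
Lemma cvg_ifs_comp_orbit p a N (y : nat -> R) (C : R) : (0 < N)%N ->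
  (forall m, `|y m| <= C) ->
  (forall m, y m = ifs_comp lam p (fun j => a (m * N + j)%N) N (y m.+1)) ->
  ifs_comp lam p a ^~ 0 @ \oo --> y 0%N.
Proof.
move=> N0 yC yS.
have yE m : ifs_comp lam p a (m * N)%N (y m) = y 0%N.
  elim: m => [//|m IH]; rewrite mulSnr ifs_compD.
  by rewrite -[ifs_comp _ _ _ N _]yS.
have cvgN : (fun m => ifs_comp lam p a (m * N)%N 0) @ \oo --> y 0%N.
  have -> : (fun m => ifs_comp lam p a (m * N)%N 0) =
      (fun m => y 0%N + lam ^+ (m * N) * (0 - y m)).
    by apply/funext => m; rewrite -(ifs_compB lam p a) yE addrC subrK.
  rewrite -[X in _ --> X]addr0; apply: cvgD; first exact: cvg_cst.
  apply: squeeze_cvgr (cvg_contraction (- C)) (cvg_contraction C).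
  near=> m; rewrite mulrN -ler_norml sub0r normrM normrN.
  rewrite ger0_norm ?exprn_ge0 ?(ltW lam_gt0)//.
  apply: ler_pM => //; first by rewrite exprn_ge0// ltW.
  by rewrite ler_wiXn2l ?(ltW lam_gt0) ?(ltW lam_lt1)// leq_pmulr.
have cvgl : cvgn (ifs_comp lam p a ^~ 0) by exact: is_cvg_ifs_comp.
suff -> : y 0%N = limn (ifs_comp lam p a ^~ 0) by [].
apply: (cvg_unique (@Rhausdorff R) cvgN).
apply: (@cvg_comp _ _ _ (muln^~ N) (ifs_comp lam p a ^~ 0) \oo \oo _ _ cvgl).
exact: cvg_mulnr.
Unshelve. all: by end_near. Qed.

End Contraction.

(** * From discrepancy to frequencies of blocks *)

Section Frequencies.
Context (R : realType) (n k : nat).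
Implicit Types (a : nat -> 'I_n.+1) (b : k.-tuple 'I_n.+1).

Lemma block_count_ratioE a b m :
  block_count_ratio R a b m = (occurrences a b m)%:R / m%:R.
Proof.
rewrite /block_count_ratio /occurrences big_mkord -sum1_card big_mkcond/=.
congr (_%:R / _); apply: eq_bigr => j _.
rewrite (_ : (j \in _) = occurs a b j); last by apply/idP/idP; rewrite inE.
by case: occurs.
Qed.

Lemma bounded_discrepancy_normal a : bounded_discrepancy k a -> k_simply_normal R k a.
Proof.
move=> abd b; have [K aK] := abd b.
have M1 : 1 <= n.+1%:R ^+ k :> R by rewrite -natrX ler1n expn_gt0.
have M0 : 0 < n.+1%:R ^+ k :> R by rewrite (lt_le_trans _ M1).
(* The shift discards [m = 0], where the ratio has denominator zero. *)
rewrite -cvg_shiftS/=.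
have cvgh (s : R) : (fun m => n.+1%:R ^- k + s * (K%:R * harmonic m)) @ \oo -->
    (n.+1%:R ^- k : R).
  rewrite -[X in _ --> X]addr0 -[0](mulr0 s) -[0](mulr0 K%:R).
  apply: cvgD; first exact: cvg_cst.
  by apply: cvgMl_tmp; apply: cvgMl_tmp; exact: cvg_harmonic.
apply: squeeze_cvgr (cvgh (-1)) (cvgh 1).
near=> m; rewrite block_count_ratioE /harmonic/= mulN1r mul1r.
have [] := aK m.+1; set c := occurrences _ _ _.
rewrite -!(ler_nat R) natrM !natrD natrM natrX => lo hi.
have m0 : 0 < m.+1%:R :> R by rewrite ltr0n.
have K0 : 0 <= K%:R :> R by rewrite ler0n.
move: M1 M0 lo hi m0 K0; set M := _ ^+ k; set x : R := m.+1%:R.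
set y : R := c%:R; set z : R := K%:R => M1 M0 lo hi m0 K0.
have zM : z <= z * M by rewrite ler_peMr.
have xM0 : 0 < x * M by rewrite mulr_gt0.
have yE : y / x * (x * M) = y * M by field; rewrite !gt_eqF.
apply/andP; split; rewrite -(ler_pM2r xM0) yE.
  have -> : (M^-1 - z / x) * (x * M) = x - z * M by field; rewrite !gt_eqF.
  lra.
have -> : (M^-1 + z / x) * (x * M) = x + z * M by field; rewrite !gt_eqF.
lra.
Unshelve. all: by end_near. Qed.

(** Otherwise the constant block of [i] would have frequency [0]. *)
Lemma k_simply_normal_letter a i : (0 < k)%N -> k_simply_normal R k a ->
  exists j, a j = i.
Proof.
move=> k0 anormal; apply: contrapT => noi.
have := anormal [tuple i | _ < k].
have -> : block_count_ratio R a [tuple i | _ < k] = fun=> 0.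
  apply/funext => m; rewrite block_count_ratioE /occurrences big1 ?mul0r// => j _.
  case: (boolP (occurs _ _ _)) => // /forallP /(_ (Ordinal k0)).
  by rewrite tnth_mktuple => /eqP aj; case: noi; exists (j + Ordinal k0)%N.
move=> /(cvg_unique (@Rhausdorff R)) /(_ (cvg_cst _)) /eqP.
by rewrite invr_eq0 expf_eq0 pnatr_eq0 andbF.
Qed.

End Frequencies.

(** * Points with a normal coding *)

Section NormalPoints.
Context (R : realType) (n k : nat) (lam : R) (p : 'I_n.+1 -> R).
Hypotheses (lam_gt0 : 0 < lam) (lam_lt1 : lam < 1) (k_gt0 : (0 < k)%N).

Definition normal_point (x : R) : Prop := exists a : nat -> 'I_n.+1,
  bounded_discrepancy k a /\ ifs_comp lam p a ^~ 0 @ \oo --> x.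

Lemma normal_point_map i x : normal_point x -> normal_point (ifs_map lam p i x).
Proof.
move=> [a [abd ax]]; exists (cons_word i a).
by split; [exact: cons_word_discrepancy | exact: cvg_cons_word].
Qed.

Context (i0 i1 : 'I_n.+1).
Hypothesis p_ge : forall i, p i0 <= p i.
Hypothesis p01 : p i0 < p i1.
Let N := lex_period n k.
Hypothesis half_le : 2^-1 <= lam ^+ N.

Definition word_map (e : bool) : R -> R :=
  ifs_comp lam p (fun m => lex_word k i0 (m + e)) N.

Let N_gt0 : (0 < N)%N.
Proof. by rewrite muln_gt0 expn_gt0. Qed.

Let rho_gt0 : 0 < lam ^+ N. Proof. exact: exprn_gt0. Qed.

Let rho_lt1 : lam ^+ N < 1.
Proof. by rewrite exprn_ilt1 ?(ltW lam_gt0)// -lt0n. Qed.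

(** With [r = lam ^+ N], the images of [[c, d]] are [[c, c + r (d - c)]] and [[d - r (d - c), d]];
    they leave no gap because [r >= 1/2]. *)
Lemma word_map_cover c d x : word_map false c = c -> word_map true d = d ->
  c <= x <= d -> exists ey : bool * R, c <= ey.2 <= d /\ x = word_map ey.1 ey.2.
Proof.
move=> fixc fixd /andP[cx xd].
have dxge0 : 0 <= d - c by rewrite subr_ge0 (le_trans cx).
have mapE e y z : word_map e y = word_map e z + lam ^+ N * (y - z).
  by rewrite -(ifs_compB lam p (fun m => lex_word k i0 (m + e))) addrC subrK.
have [xle|xgt] := leP (x - c) (lam ^+ N * (d - c)).
  exists (false, c + (x - c) / lam ^+ N); split => /=; last first.
    rewrite (mapE _ _ c) fixc; field; rewrite gt_eqF//.
  rewrite lerDl divr_ge0 ?subr_ge0 ?(ltW rho_gt0)//= -lerBrDl.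
  by rewrite ler_pdivrMr// mulrC.
exists (true, d - (d - x) / lam ^+ N); split => /=; last first.
  rewrite (mapE _ _ d) fixd; field; rewrite gt_eqF//.
rewrite gerBl divr_ge0 ?subr_ge0 ?(ltW rho_gt0)// andbT lerBrDl -lerBrDr.
rewrite ler_pdivrMr//; move: half_le dxge0 xgt; set r := lam ^+ N; nra.
Qed.

(** Iterating the choice of a preimage keeps the orbit of [x] in [[c, d]], and the booleans chosen
    on the way spell a coding of [x]. *)
Lemma normal_point_itv c d x : word_map false c = c -> word_map true d = d ->
  c <= x <= d -> normal_point x.
Proof.
move=> fixc fixd xcd.
have [g gP] : {g : R -> bool * R & forall y, c <= y <= d ->
    c <= (g y).2 <= d /\ y = word_map (g y).1 (g y).2}.
  apply: (@choice _ _ (fun y ey => c <= y <= d ->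
    c <= ey.2 <= d /\ y = word_map ey.1 ey.2)) => y.
  have [/(word_map_cover fixc fixd)[ey eyP]|ncd] := boolP (c <= y <= d).
    by exists ey.
  (* An arbitrary value outside [[c, d]], where the orbit never goes. *)
  by exists (false, 0).
pose y i := iter i (fun z => (g z).2) x.
have ycd i : c <= y i <= d by elim: i => [//|i IH]; have [] := gP _ IH.
exists (shuffle_word k i0 (fun i => (g (y i)).1)).
split; first exact: shuffle_word_discrepancy.
apply: (@cvg_ifs_comp_orbit _ _ _ lam_gt0 lam_lt1 _ _ N y (`|c| + `|d|)) => // i.
  have /andP[cy yd] := ycd i; rewrite ler_norml; apply/andP; split.
    by rewrite (le_trans _ cy)// lerNl; have := ler_norm (- c); rewrite normrN; have := normr_ge0 d; lra.
  by rewrite (le_trans yd)//; have := ler_norm d; have := normr_ge0 c; lra.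
have [_ ->] := gP _ (ycd i); apply: eq_ifs_comp => m ltm.
rewrite /shuffle_word divnMDl// divn_small// addn0 -addnA lex_word_periodM//.
Qed.

(* The point [d] is the fixed point of [word_map true]. The last inequality
   holds because [i1] occurs in the period, with weight at least
   [(1 - lam) * lam ^+ N], and [lam ^+ N >= 1 - lam ^+ N]; it prevents the
   inverse of the map of [i1] from sending a point on the right of [d] below
   [p i0]. *)
Lemma word_map_fixed : exists d, [/\ word_map true d = d,
  word_map false (ifs_map lam p i0 d) = ifs_map lam p i0 d &
  (1 - lam) * (p i1 - p i0) <= d - p i0].
Proof.
pose d := word_map true 0 / (1 - lam ^+ N); exists d.
have fixd : word_map true d = d.
  have := ifs_compB lam p (fun m => lex_word k i0 (m + true)) N d 0.
  rewrite -/(word_map true d) -/(word_map true 0) subr0 => /eqP.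
  rewrite subr_eq => /eqP ->; rewrite /d; field.
  by rewrite subr_eq0 eq_sym lt_eqF.
split => //.
  have w0 m : lex_word k i0 (m * N) = i0.
    by rewrite -[(m * N)%N]addn0 lex_word_periodM// lex_word_prefix.
  (* As words, [w1] followed by [i0] equals [i0] followed by [w2], since [C(0) = C(N) = i0]. Hence
     the map of [w1] fixes the image of [d] under the map of [i0]. *)
  rewrite {1}(_ : ifs_map lam p i0 d =
      ifs_comp lam p (fun m => lex_word k i0 (N + m + false)) 1 d); last first.
    by rewrite /= !addn0 -[N]mul1n w0.
  rewrite /word_map -(ifs_compD _ _ (fun m => lex_word k i0 (m + false))).
  rewrite addnC add1n /= (w0 0%N) -[d in RHS]fixd; congr (ifs_map _ _ _ _).
  by apply: eq_ifs_comp => m _; rewrite addn0 addn1.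
have [j ltjN wj] : exists2 j, (j < N)%N & lex_word k i0 (j + true) = i1.
  have [[j [ltj wj]]|noj] := pselect (exists j, (j < N)%N /\ lex_word k i0 j = i1).
    (* Position [0] carries [i0], which differs from [i1], so an occurrence of [i1] survives the
       shift by one. *)
    case: j ltj wj => [|j] ltj wj; last by exists j; rewrite ?addn1// ltnW.
    by move: p01; rewrite -wj lex_word_prefix// ltxx.
  have := lex_word_occurrences i0 [tuple i1 | _ < k].
  rewrite /occurrences big_nat big1 => [k0|j ltj]; first by move: k_gt0; rewrite -k0.
  case: (boolP (occurs _ _ _)) => // /forallP /(_ (Ordinal k_gt0)).
  rewrite tnth_mktuple /= addn0 => /eqP wj; case: noj; exists j; split=> //; case/andP: ltj.
have := ifs_comp_ge_letter lam_gt0 lam_lt1 (fun m => lex_word k i0 (m + true)) d p_ge ltjN.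
rewrite -/(word_map true d) fixd wj => dge.
have ltr : lam ^+ N <= lam ^+ j by rewrite ler_wiXn2l ?(ltW lam_gt0) ?(ltW lam_lt1)// ltnW.
have s0 : 0 <= (1 - lam) * (p i1 - p i0).
  by rewrite mulr_ge0 ?subr_ge0 ?(ltW lam_lt1)// ltW.
rewrite -(ler_pM2l (_ : 0 < 1 - lam ^+ N)) ?subr_gt0//.
move: dge ltr s0; rewrite mulrAC; move: ((1 - lam) * _) half_le => s.
move: (lam ^+ N) (lam ^+ j) => r rj; nra.
Qed.

(** The inverse of the map of [i0] divides the distance to [p i0] by [lam] and sends [c] to [d], so
    a point below [c] lands below [d]. The induction is on a number [m] of such steps that suffices
    to reach [c]. *)
Lemma normal_point_left c d x : c = ifs_map lam p i0 d -> p i0 < d ->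
  (forall y, c <= y <= d -> normal_point y) -> p i0 < x <= d -> normal_point x.
Proof.
move=> cE d0 cdP /andP[x0 xd].
have c0 : c - p i0 = lam * (d - p i0) by rewrite cE /ifs_map; ring.
have [m mx] : exists m, lam ^+ m * (c - p i0) <= x - p i0.
  have x0' : 0 < x - p i0 by rewrite subr_gt0.
  have /cvgr0Pnorm_lt /(_ _ x0') [m _ /(_ m (leqnn m)) /ltW mx] :=
    cvg_contraction lam_gt0 lam_lt1 (c - p i0).
  by exists m; exact: le_trans (ler_norm _) mx.
elim: m x x0 xd mx => [|m IH] x x0 xd mx.
  by apply: cdP; rewrite xd andbT; move: mx; rewrite mul1r lerD2r.
have [cx|xc] := leP c x; first by apply: cdP; rewrite cx.
have -> : x = ifs_map lam p i0 (p i0 + (x - p i0) / lam).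
  by rewrite /ifs_map; field; rewrite gt_eqF//.
apply: normal_point_map; apply: IH.
- by rewrite ltrDl divr_gt0// subr_gt0.
- by rewrite -lerBrDl ler_pdivrMr// mulrC -c0 lerD2r ltW.
- by rewrite [leRHS]addrAC subrr add0r ler_pdivlMr// mulrAC -exprSr.
Qed.

Lemma normal_point_interior x : p i0 < x < p i1 -> normal_point x.
Proof.
move=> /andP[x0 x1]; have [d [fixd fixc dge]] := word_map_fixed.
have d0 : p i0 < d.
  by rewrite -subr_gt0 (lt_le_trans _ dge)// mulr_gt0 ?subr_gt0.
have left y : p i0 < y <= d -> normal_point y.
  by apply: normal_point_left (erefl _) d0 _ => z; exact: normal_point_itv.
have [m mx] : exists m, lam ^+ m * (p i1 - d) <= p i1 - x.
  have x1' : 0 < p i1 - x by rewrite subr_gt0.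
  have /cvgr0Pnorm_lt /(_ _ x1') [m _ /(_ m (leqnn m)) /ltW mx] :=
    cvg_contraction lam_gt0 lam_lt1 (p i1 - d).
  by exists m; exact: le_trans (ler_norm _) mx.
elim: m x x0 x1 mx => [|m IH] x x0 x1 mx.
  by apply: left; rewrite x0/=; move: mx; rewrite mul1r lerD2l lerN2.
have [xd|dx] := leP x d; first by apply: left; rewrite x0.
have -> : x = ifs_map lam p i1 (p i1 - (p i1 - x) / lam).
  by rewrite /ifs_map; field; rewrite gt_eqF//.
apply: normal_point_map; apply: IH.
(* As [x > d], the bound [dge] gives [p i1 - x < lam * (p i1 - p i0)], so the preimage stays on the
   right of [p i0]. *)
- by rewrite ltrBrDl -ltrBrDr ltr_pdivrMr//; lra.
- by rewrite gtrBl divr_gt0// subr_gt0.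
- by rewrite subKr ler_pdivlMr// mulrAC -exprSr.
Qed.

End NormalPoints.

(** * The attractor *)

Section Attractor.
Context (R : realType) (n : nat) (lam : R) (X : set R).
Hypotheses (lam_gt0 : 0 < lam) (lam_lt1 : lam < 1).
Implicit Types p : 'I_n.+1 -> R.

(** Self-similarity gives [sup X <= lam * sup X + (1 - lam) * hi]. *)
Lemma attractor_le p hi : is_attractor lam p X -> (forall i, p i <= hi) ->
  forall x, X x -> x <= hi.
Proof.
move=> [X0 [cX XE]] phi.
have [_ ubX] := compact_has_sup X0 cX.
suff sup_hi : sup X <= hi.
  by move=> x Xx; rewrite (le_trans _ sup_hi)//; exact: ub_le_sup.
have : sup X <= lam * sup X + (1 - lam) * hi.
  apply: ge_sup => // x; rewrite {1}XE => -[i _ [y Xy <-]]; rewrite /ifs_map.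
  by apply: lerD; rewrite ler_pM2l ?subr_gt0//; exact: ub_le_sup.
by move=> h; rewrite -(ler_pM2l (_ : 0 < 1 - lam)) ?subr_gt0//; lra.
Qed.

Lemma attractor_ge p lo : is_attractor lam p X -> (forall i, lo <= p i) ->
  forall x, X x -> lo <= x.
Proof.
move=> [X0 [cX XE]] plo.
have lbX : has_lbound X.
  have [M [_ MX]] := compact_bounded cX; exists (- (M + 1)) => y /MX yM.
  have : `|y| <= M + 1 by apply: yM; rewrite ltrDl.
  by rewrite ler_norml => /andP[].
suff lo_inf : lo <= inf X.
  by move=> x Xx; rewrite (le_trans lo_inf)//; exact: ge_inf.
have : lam * inf X + (1 - lam) * lo <= inf X.
  apply: lb_le_inf => // x; rewrite {1}XE => -[i _ [y Xy <-]]; rewrite /ifs_map.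
  by apply: lerD; rewrite ler_pM2l ?subr_gt0//; exact: ge_inf.
by move=> h; rewrite -(ler_pM2l (_ : 0 < 1 - lam)) ?subr_gt0//; lra.
Qed.

(** Compositions started at a point of [X] stay in the closed set [X] and have the same limit. *)
Lemma attractor_cvg p a x : is_attractor lam p X ->
  ifs_comp lam p a ^~ 0 @ \oo --> x -> X x.
Proof.
move=> [[x0 Xx0] [cX XE]] ax.
apply: (@closed_cvg nat R \oo _ (ifs_comp lam p a ^~ x0) X).
- by apply: compact_closed cX; exact: Rhausdorff.
- apply: nearW => j; elim: j a {ax} => [|j IH] a //=; rewrite XE.
  by exists (a 0%N) => //; exists (ifs_comp lam p (fun m => a m.+1) j x0).
- exact: ifs_comp_cvg_start ax.
Qed.

End Attractor.

Lemma half_le_exprn (R : realType) (N : nat) (x : R) : (0 < N)%N ->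
  (2^-1 : R) `^ (1 / N%:R) < x -> 2^-1 <= x ^+ N.
Proof.
move=> N0 ltx; have -> : (2^-1 : R) = ((2^-1 : R) `^ (1 / N%:R)) ^+ N.
  rewrite -powR_mulrn ?powR_ge0// -powRrM div1r mulVf ?pnatr_eq0 -?lt0n//.
  by rewrite powRr1.
by rewrite lerXn2r ?nnegrE ?powR_ge0 ?(ltW ltx)// (le_trans (powR_ge0 _ _) (ltW ltx)).
Qed.

Theorem theorem6p2 (R : realType) (n k : nat) (p : 'I_n.+1 -> R)
  (theta lam : R) (X : set R) :
  (exists i j : 'I_n.+1, p i != p j) ->
  (1 <= k)%N ->
  theta ^+ 3 - theta - 1 = 0 ->
  (2^-1 : R) `^ (1 / (k * (n.+1) ^ k)%:R) < lam ->
  theta `^ (- (2^-1)) < lam ->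
  lam < 1 ->
  is_attractor lam p X ->
  Xk k lam p X = interior X.
Proof.
move=> [i [j pij]] k_gt0 _ lam_half _ lam_lt1 Xattr.
have lam_gt0 : 0 < lam := le_lt_trans (powR_ge0 _ _) lam_half.
have half_le : 2^-1 <= lam ^+ lex_period n k.
  rewrite /lex_period mulnC; apply: half_le_exprn lam_half.
  by rewrite muln_gt0 k_gt0 expn_gt0.
have [i0 p_ge] : exists i0, forall i, p i0 <= p i.
  by case: (arg_minP p (i0 := ord0) (P := predT) isT) => i0 _ h; exists i0 => ?; exact: h.
have [i1 p_le] : exists i1, forall i, p i <= p i1.
  by case: (arg_maxP p (i0 := ord0) (P := predT) isT) => i1 _ h; exists i1 => ?; exact: h.
have p01 : p i0 < p i1.
  rewrite lt_neqAle p_ge andbT; apply: contra pij => /eqP p01.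
  by rewrite eq_le; apply/andP; split; rewrite (le_trans (p_le _))// -p01 p_ge.
have itvX x : p i0 < x < p i1 -> X x.
  move=> /(normal_point_interior lam_gt0 lam_lt1 k_gt0 p_ge p01 half_le).
  by move=> [a [_ ax]]; exact: attractor_cvg Xattr ax.
(* [X] contains the open interval and lies in the closed one, which determines its interior. *)
have intE (x : R) : interior X x <-> p i0 < x < p i1.
  split=> [Xx|xp].
    have [e /= e0 eX] : exists2 e : R, 0 < e & ball x e `<=` X by move/nbhs_ballP: Xx.
    have xe (s : R) : `|s| < e -> X (x + s).
      by move=> se; apply: eX; rewrite /ball/= opprD addrA subrr sub0r normrN.
    have e2 : `|e / 2| < e by rewrite ger0_norm; lra.
    have e2' : `|- (e / 2)| < e by rewrite normrN.
    have := attractor_le lam_gt0 lam_lt1 Xattr p_le (xe _ e2).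
    have := attractor_ge lam_gt0 lam_lt1 Xattr p_ge (xe _ e2').
    by move=> h1 h2; apply/andP; split; lra.
  have : (`]p i0, p i1[%classic : set R) `<=` interior X.
    rewrite -open_subsetE; last exact: interval_open.
    by move=> y /=; rewrite in_itv/= => /itvX.
  by apply; rewrite /= in_itv.
apply/seteqP; split => x.
  move=> [Xx [a [anormal ax]]]; apply/intE.
  have acvg : ifs_comp lam p a ^~ 0 @ \oo --> x.
    by rewrite -ax; exact: is_cvg_ifs_comp.
  (* A normal coding uses both extreme letters, which keeps [x] away from both endpoints. *)
  have [j0 aj0] := k_simply_normal_letter i0 k_gt0 anormal.
  have [j1 aj1] := k_simply_normal_letter i1 k_gt0 anormal.
  have dp (m : nat) : 0 < (1 - lam) * lam ^+ m * (p i1 - p i0).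
    by rewrite !mulr_gt0 ?subr_gt0// exprn_gt0.
  apply/andP; split.
    have := dp j1; rewrite -(ltrD2l (p i0)) addr0 => /lt_le_trans; apply.
    (* Starting at [p i0] instead of [0] cancels the term in [lam ^+ m], so the bound is uniform in
       [m] and passes to the limit. *)
    apply: (@closed_cvg nat R \oo _ (ifs_comp lam p a ^~ (p i0)) (fun y => _ <= y)).
    - exact: closed_ge.
    - near=> m.
      have lt1m : (j1 < m)%N by near: m; exact: nbhs_infty_gt.
      have := ifs_comp_ge_letter lam_gt0 lam_lt1 a (p i0) p_ge lt1m.
      by rewrite subrr mulr0 addr0 aj1.
    - exact: ifs_comp_cvg_start acvg.
  have := dp j0; rewrite -(ltrD2r (p i1 - (1 - lam) * lam ^+ j0 * (p i1 - p i0))).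
  rewrite add0r addrCA subrr addr0 => /(le_lt_trans _); apply.
  apply: (@closed_cvg nat R \oo _ (ifs_comp lam p a ^~ (p i1)) (fun y => y <= _)).
  - exact: closed_le.
  - near=> m.
    have lt0m : (j0 < m)%N by near: m; exact: nbhs_infty_gt.
    have := ifs_comp_le_letter lam_gt0 lam_lt1 a (p i1) p_le lt0m.
    by rewrite subrr mulr0 addr0 aj0.
  - exact: ifs_comp_cvg_start acvg.
move=> /[dup] /interior_subset Xx /intE xp; split => //.
have [a [abd ax]] :=
  normal_point_interior lam_gt0 lam_lt1 k_gt0 p_ge p01 half_le xp.
exists a; split; first exact: bounded_discrepancy_normal.
exact: cvg_lim ax.
Unshelve. all: by end_near. Qed.
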